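(* Let $a\ge 2$, $c>0$, $d$ be integers with $d<ca$ and $\gcd(d,a)=\gcd(d,c)=1$, let $n\ge 1$, and let $\mathbf s_j=ca^{n+j}-d$ for $j\in\mathbb N$ and $S_n=\langle\{\mathbf s_j:j\in\mathbb N\}\rangle$. Let $\lambda=\gcd(S_n)$. Let $m$ be the smallest positive integer such that $\mathbf s_0/\lambda\le \mathbf R_m$, and assume that $\mathbf s_1/\lambda\ge \mathbf R_m$. Then $e(S_n)=m$.
   Context: $\mathbb N=\{0,1,2,\ldots\}$. For $A\subseteq\mathbb N$, $\langle A\rangle$ is the submonoid of $(\mathbb N,+)$ generated by $A$. For a nontrivial submonoid $M$ of $\mathbb N$, the minimal generating set of $M$ is the unique generating set contained in every generating set of $M$ (its elements are the nonzero elements of $M$ that are not sums of two nonzero elements of $M$; it is finite), and $e(M)$ is its cardinality. $\gcd(M)$ denotes the greatest common divisor of all elements of $M$. The repunit numbers in base $a$ are $\mathbf R_0=0$ and $\mathbf R_k=1+a+\cdots+a^{k-1}=(a^k-1)/(a-1)$ for $k\ge 1$. *)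

(* Defs.v *)
From mathcomp Require Import all_boot all_order all_algebra.
From mathcomp Require Import boolp classical_sets functions cardinality.

Set Implicit Arguments.
Unset Strict Implicit.
Unset Printing Implicit Defensive.

Import GRing.Theory Num.Theory.

Local Open Scope classical_set_scope.
Local Open Scope card_scope.

Definition submonoid (M : set nat) : Prop :=
  M 0 /\ forall x y, M x -> M y -> M (x + y).

Definition submonoid_gen (A : set nat) : set nat := smallest submonoid A.

Definition minimal_generating_set (M A : set nat) : Prop :=
  submonoid_gen A = M /\ forall B : set nat, submonoid_gen B = M -> A `<=` B.

(* Such an [A] is unique, being contained in every other one, so [e] is
   determined by [M]. *)
Definition embedding_dimension (M : set nat) (e : nat) : Prop :=
  exists A : set nat, minimal_generating_set M A /\ A #= `I_e.

Definition is_gcd (M : set nat) (g : nat) : Prop :=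
  (forall x, M x -> g %| x) /\
  (forall k, (forall x, M x -> k %| x) -> k %| g).

Definition repunit (a k : nat) : nat := \sum_(i < k) a ^ i.

Definition sseq (a c : nat) (d : int) (n j : nat) : int :=
  ((c * a ^ (n + j))%N%:Z - d)%R.

(* The numbers [sseq a c d n j] are positive when [d < c * a] and [1 <= n], so
   casting the generators to [nat] loses none of them. *)
Definition S_monoid (a c : nat) (d : int) (n : nat) : set nat :=
  submonoid_gen [set x : nat | exists j : nat, x%:Z%R = sseq a c d n j].

(* Main.v *)
(** Put [s_j = c a^(n+j) - d]. Since [s_j = s_0 + P R_j] with
    [P = c a^n (a - 1)], we have [lambda = gcd(s_0, P)]; write
    [s_0 = lambda t] and [P = lambda K] with [t], [K] coprime. The minimal
    generators are [s_0, ..., s_(m-1)].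

    They generate: [R_m = t + e] with [0 <= e <= K] gives
    [s_m = (1 + K - e) s_0 + e s_1], and if [s_j = s_i + y] with [i < m] and
    [y] in the monoid they generate, then [s_(j+1) = s_(i+1) + a y].

    They are irreducible: every nonzero element of [S_n] is [r s_0 + P w] with
    [r >= 1], so a decomposition of [s_k] yields [(r - 1) t = K (R_k - w)] with
    [r >= 2]. Then [t] divides [R_k - w > 0], whereas [R_k < t] for
    [0 < k < m]. *)

Require Import Defs.
From mathcomp Require Import all_boot all_order all_algebra.
From mathcomp Require Import boolp classical_sets functions cardinality.
From mathcomp Require Import zify ring.

Import Order.TTheory GRing.Theory Num.Theory.

Lemma submonoid_gen_submonoid (A : set nat) : submonoid (submonoid_gen A).
Proof.
split=> [B [[B0 _] _] //|x y xA yA B HB].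
by apply: HB.1.2; [apply: xA|apply: yA].
Qed.

Lemma mem_submonoid_gen (A : set nat) (x : nat) : A x -> submonoid_gen A x.
Proof. by move=> Ax B [_]; apply. Qed.

Lemma submonoid_gen_min (A B : set nat) :
  submonoid B -> (A `<=` B)%classic -> (submonoid_gen A `<=` B)%classic.
Proof. by move=> subB AB x; apply. Qed.

Lemma submonoid_mul (M : set nat) (k x : nat) :
  submonoid M -> M x -> M (k * x).
Proof.
move=> [M0 MD] Mx; elim: k => [|k IHk]; first by rewrite mul0n.
by rewrite mulSn; apply: MD.
Qed.

Lemma submonoid_gen_split (A : set nat) (x : nat) :
  submonoid_gen A x ->
  x = 0 \/ exists g y, [/\ A g, submonoid_gen A y & x = g + y].
Proof.
have [A0 AD] := submonoid_gen_submonoid A.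
move=> /(_ (fun z => z = 0 \/ exists g y,
  [/\ A g, submonoid_gen A y & z = g + y])); apply; split=> [|g Ag]; last by right; exists g, 0; rewrite addn0.
split=> [|u v Hu Hv]; first by left.
case: Hu => [->//|[g [y [Ag Ay ->]]]]; right.
exists g, (y + v); rewrite addnA; split=> //; apply: (AD) => //.
case: Hv => [->//|[g' [y' [Ag' Ay' ->]]]].
by apply: AD => //; exact: mem_submonoid_gen.
Qed.

Lemma irreducible_in_generators (B : set nat) (x : nat) :
  submonoid_gen B x -> x <> 0 ->
  (forall u v, submonoid_gen B u -> submonoid_gen B v ->
    0 < u -> 0 < v -> x <> u + v) ->
  B x.
Proof.
move=> Mx x0 irr; apply: contrapT => nBx.
have [M0 MD] := submonoid_gen_submonoid B.
(* An irreducible element can be removed from a submonoid. *)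
have subMx : submonoid (fun y => submonoid_gen B y /\ y <> x).
  split=> [|u v [Mu ux] [Mv vx]]; first by split=> // /esym.
  split; first exact: MD.
  case: (posnP u) => [->|u0]; first by rewrite add0n.
  case: (posnP v) => [->|v0]; first by rewrite addn0.
  by move=> /esym; apply: irr.
have sub : (B `<=` fun y => submonoid_gen B y /\ y <> x)%classic.
  by move=> y By; split; [exact: mem_submonoid_gen|move=> yx; rewrite yx in By].
by have [] := submonoid_gen_min _ _ subMx sub x Mx.
Qed.

Lemma repunit0 (a : nat) : repunit a 0 = 0.
Proof. by rewrite /repunit big_ord0. Qed.

Lemma repunitS (a k : nat) : repunit a k.+1 = (a * repunit a k).+1.
Proof.
rewrite /repunit big_ord_recl expn0 add1n big_distrr /=; congr _.+1.
by apply: eq_bigr => i _; rewrite expnS.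
Qed.

Lemma repunit1 (a : nat) : repunit a 1 = 1.
Proof. by rewrite repunitS repunit0 muln0. Qed.

Lemma repunit_inj (a : nat) : 0 < a -> injective (repunit a).
Proof.
move=> a0; apply: incn_inj; apply: leq_mono; apply: homo_ltn => [|k].
  exact: ltn_trans.
by rewrite repunitS ltnS leq_pmull.
Qed.

(** The form of [sseq] in natural numbers, with [s] for $s_0$: neither [d] nor a subtraction is
    left. *)
Definition affine_repunit (s P a j : nat) : nat := s + P * repunit a j.

Lemma affine_repunit0 (s P a : nat) : affine_repunit s P a 0 = s.
Proof. by rewrite /affine_repunit repunit0 muln0 addn0. Qed.

Lemma affine_repunit1 (s P a : nat) : affine_repunit s P a 1 = s + P.
Proof. by rewrite /affine_repunit repunit1 muln1. Qed.

(** The recurrence $s_{j+1} = a s_j + (s + P - a s)$ has a constant term independent of $j$, so a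
    shift of indices multiplies differences by $a$. *)
Lemma affine_repunitS (s P a i j y : nat) :
  affine_repunit s P a j = affine_repunit s P a i + y ->
  affine_repunit s P a j.+1 = affine_repunit s P a i.+1 + a * y.
Proof. by rewrite /affine_repunit !repunitS => H; nia. Qed.

Lemma affine_repunit_inj (s P a : nat) :
  0 < a -> 0 < P -> injective (affine_repunit s P a).
Proof.
move=> a0 P0 i j /addnI/eqP; rewrite eqn_pmul2l // => /eqP.
exact: repunit_inj.
Qed.

Lemma affine_repunit_generated (l t K a m : nat) :
  0 < l * t -> 0 < m -> t <= repunit a m <= t + K ->
  let s := affine_repunit (l * t) (l * K) a in
  forall j, submonoid_gen (s @` `I_m)%classic (s j).
Proof.
move=> s0 m0 /andP[tR Rt] s; set A := image _ _.
have subA := submonoid_gen_submonoid A; have [_ AD] := subA.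
have sA i : i < m -> submonoid_gen A (s i).
  by move=> im; apply: (mem_submonoid_gen A (s i)); exists i.
have sm : submonoid_gen A (s m).
  have [e Re] : exists e, repunit a m = t + e.
    by exists (repunit a m - t); rewrite subnKC.
  have eK : e <= K by rewrite -(leq_add2l t) -Re.
  (* Both sides equal $lt + lK(t + e)$; [eK] keeps the coefficient $K - e$ from being truncated. *)
  have -> : s m = (K - e).+1 * s 0 + e * s 1.
    rewrite /s affine_repunit0 affine_repunit1 /affine_repunit Re.
    by rewrite -[in LHS](subnK eK) -[in e * _](subnK eK); ring.
  apply: AD; first by apply: (submonoid_mul _ _ _ subA); exact: sA.
  (* If $m = 1$, then $s_1$ is not an available generator, but $0 < t \le R_1 = 1$ forces $e =
     0$. *)
  case: (ltnP 1 m) => [m1|m1]; first by apply: (submonoid_mul _ _ _ subA); exact: sA.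
  have m_1 : m = 1 by apply/eqP; rewrite eqn_leq m1.
  have -> : e = 0 by move: Re s0; rewrite m_1 repunit1; nia.
  by rewrite mul0n; exact: subA.1.
elim=> [|j IHj]; first exact: sA.
case: (submonoid_gen_split _ _ IHj) => [sj0|[_ [y [[i im <-] Ay /esym sj]]]].
  by move: s0; rewrite lt0n; case/eqP; move: sj0; rewrite /s /affine_repunit; nia.
rewrite /s (affine_repunitS _ _ _ _ _ _ (esym sj)).
apply: AD; last exact: (submonoid_mul _ _ _ subA).
(* The shifted generator is either $s_m$, treated above, or still one of the first $m$. *)
by move: (im : i.+1 <= m); rewrite leq_eqVlt => /predU1P[->|/sA].
Qed.

(** Each generator brings one copy of [s]. The implication expresses $r \ge 1$ for nonzero elements
    in a form that also holds at $0$ and is stable under sums. *)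
Lemma affine_repunit_span (s P a x : nat) :
  submonoid_gen (range (affine_repunit s P a)) x ->
  exists r w, x = r * s + P * w /\ (r = 0 -> w = 0).
Proof.
move=> /(_ (fun z => exists r w, z = r * s + P * w /\ (r = 0 -> w = 0))).
apply; split=> [|_ [j _ <-]]; last first.
  by exists 1, (repunit a j); rewrite mul1n.
split=> [|_ _ [r [w [-> rw]]] [r' [w' [-> rw']]]].
  by exists 0, 0; rewrite muln0.
exists (r + r'), (w + w'); split; first ring.
by move=> /eqP; rewrite addn_eq0 => /andP[/eqP/rw-> /eqP/rw'->].
Qed.

Lemma affine_repunit_irreducible (l t K a k u v : nat) :
  0 < l -> coprime t K -> (0 < k -> repunit a k < t) -> 0 < t ->
  let s := affine_repunit (l * t) (l * K) a in
  submonoid_gen (range s) u -> submonoid_gen (range s) v ->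
  0 < u -> 0 < v -> s k <> u + v.
Proof.
move=> l0 tK Rk t0 s /affine_repunit_span[r [w [-> rw]]].
move=> /affine_repunit_span[r' [w' [-> rw']]] u0 v0.
have {rw u0} r0 : 0 < r.
  by rewrite lt0n; apply/eqP => re; move: u0; rewrite re rw // !muln0.
have {rw' v0} r'0 : 0 < r'.
  by rewrite lt0n; apply/eqP => re; move: v0; rewrite re rw' // !muln0.
case: r r0 => // r _; case: r' r'0 => // r' _ E.
(* The multiplicities are now $r + 1$ and $r' + 1$; cancelling the single [s] of $s_k$ leaves $r +
   r' + 1 > 0$ copies. *)
have {}E : (r + r').+1 * t + K * (w + w') = K * repunit a k.
  apply/eqP; rewrite -(eqn_pmul2l l0); apply/eqP.
  by move: E; rewrite /s /affine_repunit; lia.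
have wR : w + w' < repunit a k.
  by rewrite ltnNge; apply/negP => /(leq_mul (leqnn K)); nia.
have tR : t %| repunit a k - (w + w').
  rewrite -(Gauss_dvdr _ tK) mulnBr -E addnK; exact: dvdn_mull.
have k0 : 0 < k by case: k wR {Rk E tR s} => //; rewrite repunit0.
have := dvdn_leq _ tR; rewrite subn_gt0 wR => /(_ isT).
by move: (Rk k0); lia.
Qed.

Theorem theorem3p8 (a c : nat) (d : int) (n lambda m : nat)
  (ha : 2 <= a) (hc : 0 < c)
  (hd : (d < (c * a)%N%:Z)%R)
  (hda : coprimez d a%:Z%R) (hdc : coprimez d c%:Z%R)
  (hn : 1 <= n)
  (hlambda : is_gcd (S_monoid a c d n) lambda)
  (hm_pos : 0 < m)
  (hm : (((sseq a c d n 0) %/ lambda%:Z)%Z <= (repunit a m)%:Z)%R)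
  (hm_min : forall k : nat, 0 < k ->
     (((sseq a c d n 0) %/ lambda%:Z)%Z <= (repunit a k)%:Z)%R -> m <= k)
  (hs1 : ((repunit a m)%:Z <= ((sseq a c d n 1) %/ lambda%:Z)%Z)%R) :
  embedding_dimension (S_monoid a c d n) m.
Proof.
have [P P0 [s0 s00 sE]] : exists2 P, 0 < P & exists2 s0, 0 < s0 &
    forall j, sseq a c d n j = (affine_repunit s0 P a j)%:Z%R.
  have a0 : 0 < a by exact: ltnW.
  exists (c * a ^ n * a.-1).
    by rewrite !muln_gt0 hc expn_gt0 a0 -subn1 subn_gt0.
  (* As $n \ge 1$, $d < ca \le ca^n$, so $s_0 > 0$ and [absz] below changes nothing. *)
  have can : (d < (c * a ^ n)%N%:Z)%R.
    apply: (lt_le_trans hd); rewrite lez_nat leq_mul2l -[X in X <= _]expn1.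
    by rewrite leq_exp2l // hn orbT.
  exists (absz ((c * a ^ n)%N%:Z - d)%R); first by lia.
  move=> j; rewrite /sseq /affine_repunit -mulnA -predn_exp expnD.
  have : 0 < a ^ j by rewrite expn_gt0 a0.
  by case: (a ^ j) => // q _; lia.
move: hlambda hm hm_min hs1.
have -> : S_monoid a c d n = submonoid_gen (range (affine_repunit s0 P a)).
  rewrite /S_monoid; congr submonoid_gen; rewrite eqEsubset; split=> x.
    by move=> [j]; rewrite sE => -[->]; exists j.
  by move=> [j _ <-]; exists j; rewrite sE.
rewrite !sE affine_repunit0 affine_repunit1.
move=> [lM maxl].
have sM j : submonoid_gen (range (affine_repunit s0 P a))
    (affine_repunit s0 P a j).
  exact: (mem_submonoid_gen _ _ (ex_intro2 _ _ j I erefl)).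
have ls0 : lambda %| s0 by have := lM _ (sM 0); rewrite affine_repunit0.
have lP : lambda %| P.
  by have := lM _ (sM 1); rewrite affine_repunit1 dvdn_addr.
move: maxl s00 P0 sM {sE lM}.
case/dvdnP: ls0 => t ->; case/dvdnP: lP => K ->; rewrite ![_ * lambda]mulnC.
set s := affine_repunit _ _ _ => maxl lt0 lK0 sM.
have /andP[l0 t0] : (0 < lambda) && (0 < t) by rewrite -muln_gt0.
(* The quotients by [lambda] are exact: the bounds become $t \le R_m \le t + K$. *)
rewrite -mulnDr !divz_nat !mulKn // !lez_nat => tR tmin Rt.
have Rlt k : k < m -> 0 < k -> repunit a k < t.
  move=> km k0; rewrite ltnNge; apply/negP => tk.
  by have := tmin k k0; rewrite lez_nat => /(_ tk); rewrite leqNgt km.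
(* $\lambda\gcd(t, K)$ divides every $r s_0 + P w$, hence divides $\lambda$. *)
have coptK : coprime t K.
  have : lambda * gcdn t K %| lambda.
    apply: maxl => x /affine_repunit_span[r [w [-> _]]].
    apply: dvdn_add; [apply: dvdn_mull|apply: dvdn_mulr];
      by rewrite dvdn_pmul2l // (dvdn_gcdl, dvdn_gcdr).
  by rewrite -[X in _ %| X]muln1 dvdn_pmul2l // dvdn1.
exists (s @` `I_m)%classic; split; last first.
  by apply: inj_card_eq => i j _ _; apply: affine_repunit_inj => //; exact: ltnW.
split.
  rewrite eqEsubset; split; apply: submonoid_gen_min;
    try exact: submonoid_gen_submonoid.
    by move=> _ [i _ <-]; exact: sM.
  by move=> _ [i _ <-]; apply: affine_repunit_generated => //; rewrite tR.
(* Any generating set [B] must contain the irreducible elements, in particular $s_i$ for $i < m$. *)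
move=> B genB _ [i im <-]; apply: irreducible_in_generators.
- by rewrite genB; exact: sM.
- by rewrite /s /affine_repunit => /eqP; rewrite addn_eq0 -[_ == 0]negbK -lt0n lt0.
- move=> u v; rewrite genB; apply: affine_repunit_irreducible => //.
  exact: Rlt.
Qed.
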